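(* Let $K$ be a field of characteristic not $2$ or $3$. Let $(A,[\cdot,\cdot],\{\cdot,\cdot,\cdot\})$ be a Bol superalgebra over $K$ and $\beta$ an even self-morphism of it. Define on $A$ $$[x,y]_\beta:=\beta([x,y]),\qquad \{x,y,z\}_\beta:=\beta^2(\{x,y,z\}).$$ Then $\mathcal{A}_\beta:=(A,[\cdot,\cdot]_\beta,\{\cdot,\cdot,\cdot\}_\beta,\beta)$ is a Hom-Bol superalgebra. Moreover, if $(A',[\cdot,\cdot]',\{\cdot,\cdot,\cdot\}')$ is another Bol superalgebra over $K$, $\beta'$ is an even self-morphism of it, and $f:A\to A'$ is an even morphism of Bol superalgebras satisfying $f\circ\beta=\beta'\circ f$, then $f:\mathcal{A}_\beta\to\mathcal{A}'_{\beta'}$ is a morphism of Hom-Bol superalgebras, where $\mathcal{A}'_{\beta'}:=(A',[\cdot,\cdot]'_{\beta'},\{\cdot,\cdot,\cdot\}'_{\beta'},\beta')$ with $[x,y]'_{\beta'}:=\beta'([x,y]')$ and $\{x,y,z\}'_{\beta'}:=\beta'^2(\{x,y,z\}')$.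
   Context: A superspace is a $\mathbb{Z}_2$-graded vector space $A=A_0\oplus A_1$; an element $x\in A_i$ is homogeneous of degree $\bar x=i$. A linear map $f:A\to A'$ of superspaces is even if $f(A_i)\subset A'_i$ for $i=0,1$. A Hom-Bol superalgebra is a quadruple $(A,[\cdot,\cdot],\{\cdot,\cdot,\cdot\},\alpha)$ where $A$ is a superspace, $[\cdot,\cdot]$ is a bilinear and $\{\cdot,\cdot,\cdot\}$ a trilinear operation on $A$, both compatible with the grading ($[A_i,A_j]\subset A_{i+j}$, $\{A_i,A_j,A_k\}\subset A_{i+j+k}$), and $\alpha:A\to A$ is an even linear map, such that for all homogeneous $u,v,w,x,y,z\in A$: (1) $\alpha([x,y])=[\alpha(x),\alpha(y)]$; (2) $\alpha(\{x,y,z\})=\{\alpha(x),\alpha(y),\alpha(z)\}$; (3) $[x,y]=-(-1)^{\bar x\bar y}[y,x]$; (4) $\{x,y,z\}=-(-1)^{\bar x\bar y}\{y,x,z\}$; (5) $\{x,y,z\}+(-1)^{\bar x(\bar y+\bar z)}\{y,z,x\}+(-1)^{\bar z(\bar x+\bar y)}\{z,x,y\}=0$; (6) $\{\alpha(x),\alpha(y),[u,v]\}=[\{x,y,u\},\alpha^2(v)]+(-1)^{\bar u(\bar x+\bar y)}[\alpha^2(u),\{x,y,v\}]+(-1)^{(\bar x+\bar y)(\bar u+\bar v)}\big(\{\alpha(u),\alpha(v),[x,y]\}-[[\alpha(u),\alpha(v)],[\alpha(x),\alpha(y)]]\big)$; (7) $\{\alpha^2(x),\alpha^2(y),\{u,v,w\}\}=\{\{x,y,u\},\alpha^2(v),\alpha^2(w)\}+(-1)^{\bar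 u(\bar x+\bar y)}\{\alpha^2(u),\{x,y,v\},\alpha^2(w)\}+(-1)^{(\bar x+\bar y)(\bar u+\bar v)}\{\alpha^2(u),\alpha^2(v),\{x,y,w\}\}$. A Bol superalgebra is a triple $(A,[\cdot,\cdot],\{\cdot,\cdot,\cdot\})$ such that $(A,[\cdot,\cdot],\{\cdot,\cdot,\cdot\},\mathrm{Id})$ is a Hom-Bol superalgebra, i.e. satisfying (3)–(7) with $\alpha=\mathrm{Id}$. An even morphism of Bol superalgebras is an even linear map $f:A\to A'$ with $f([x,y])=[f(x),f(y)]'$ and $f(\{x,y,z\})=\{f(x),f(y),f(z)\}'$; an even self-morphism is such a map with $A'=A$. A morphism of Hom-Bol superalgebras is an even linear map that preserves the binary and ternary operations in the same sense and intertwines the twisting maps ($f\circ\alpha=\alpha'\circ f$). *)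

(* Defs.v *)
From mathcomp Require Import all_boot all_algebra.

Set Implicit Arguments.
Unset Strict Implicit.
Unset Printing Implicit Defensive.

Import GRing.Theory.
Local Open Scope ring_scope.

Definition subspace (K : fieldType) (V : lmodType K) (P : V -> Prop) : Prop :=
  P 0 /\ forall (a : K) (u v : V), P u -> P v -> P (a *: u + v).

(* [homog i x] reads "x lies in A_i".  The zero vector lies in both parts, so a
   homogeneous element is quantified together with a degree witnessing
   membership; every graded identity below is trivial on zero arguments. *)
Record superspace (K : fieldType) := Superspace {
  carrier :> lmodType K;
  homog : 'Z_2 -> carrier -> Prop;
  homog_subspace : forall i, subspace (homog i);
  homog_span : forall x, exists x0 x1, [/\ homog 0 x0, homog 1 x1 & x = x0 + x1];
  homog_direct : forall x, homog 0 x -> homog 1 x -> x = 0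
}.

(* (-1)^i; degrees are computed in the ring 'Z_2, which is harmless since the
   sign only depends on the parity of the exponent. *)
Definition sgn (K : fieldType) (i : 'Z_2) : K := (-1) ^+ (i : nat).
Arguments sgn {K} i.

Section Definitions.
Variable K : fieldType.
Implicit Types A B : superspace K.

Definition even_linear A B (f : A -> B) : Prop :=
  linear f /\ forall (i : 'Z_2) (x : A), homog i x -> homog i (f x).

Definition bilinear_op A (br : A -> A -> A) : Prop :=
  (forall y, linear (fun x => br x y)) /\ (forall x, linear (br x)).

Definition trilinear_op A (tr : A -> A -> A -> A) : Prop :=
  [/\ forall y z, linear (fun x => tr x y z),
      forall x z, linear (fun y => tr x y z)
    & forall x y, linear (tr x y)].

Record hom_bol A (br : A -> A -> A) (tr : A -> A -> A -> A) (al : A -> A) :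
    Prop := HomBol {
  hb_br_bilinear : bilinear_op br;
  hb_tr_trilinear : trilinear_op tr;
  hb_br_graded : forall (i j : 'Z_2) (x y : A),
    homog i x -> homog j y -> homog (i + j) (br x y);
  hb_tr_graded : forall (i j k : 'Z_2) (x y z : A),
    homog i x -> homog j y -> homog k z -> homog (i + j + k) (tr x y z);
  hb_al_even_linear : even_linear al;
  hb_al_br : forall (i j : 'Z_2) (x y : A), homog i x -> homog j y ->
    al (br x y) = br (al x) (al y);
  hb_al_tr : forall (i j k : 'Z_2) (x y z : A),
    homog i x -> homog j y -> homog k z ->
    al (tr x y z) = tr (al x) (al y) (al z);
  hb_br_antisym : forall (i j : 'Z_2) (x y : A), homog i x -> homog j y ->
    br x y = - (sgn (i * j) *: br y x);
  hb_tr_antisym : forall (i j k : 'Z_2) (x y z : A),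
    homog i x -> homog j y -> homog k z ->
    tr x y z = - (sgn (i * j) *: tr y x z);
  hb_tr_cyclic : forall (i j k : 'Z_2) (x y z : A),
    homog i x -> homog j y -> homog k z ->
    tr x y z + sgn (i * (j + k)) *: tr y z x
             + sgn (k * (i + j)) *: tr z x y = 0;
  hb_tr_br : forall (i j k l : 'Z_2) (x y u v : A),
    homog i x -> homog j y -> homog k u -> homog l v ->
    tr (al x) (al y) (br u v) =
      br (tr x y u) (al (al v))
      + sgn (k * (i + j)) *: br (al (al u)) (tr x y v)
      + sgn ((i + j) * (k + l)) *:
          (tr (al u) (al v) (br x y)
           - br (br (al u) (al v)) (br (al x) (al y)));
  hb_tr_tr : forall (i j k l m : 'Z_2) (x y u v w : A),
    homog i x -> homog j y -> homog k u -> homog l v -> homog m w ->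
    tr (al (al x)) (al (al y)) (tr u v w) =
      tr (tr x y u) (al (al v)) (al (al w))
      + sgn (k * (i + j)) *: tr (al (al u)) (tr x y v) (al (al w))
      + sgn ((i + j) * (k + l)) *: tr (al (al u)) (al (al v)) (tr x y w)
}.

Definition bol A (br : A -> A -> A) (tr : A -> A -> A -> A) : Prop :=
  hom_bol br tr id.

Definition bol_morphism A B
    (br : A -> A -> A) (tr : A -> A -> A -> A)
    (br' : B -> B -> B) (tr' : B -> B -> B -> B) (f : A -> B) : Prop :=
  [/\ even_linear f,
      forall x y, f (br x y) = br' (f x) (f y)
    & forall x y z, f (tr x y z) = tr' (f x) (f y) (f z)].

Definition hom_bol_morphism A B
    (br : A -> A -> A) (tr : A -> A -> A -> A) (al : A -> A)
    (br' : B -> B -> B) (tr' : B -> B -> B -> B) (al' : B -> B)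
    (f : A -> B) : Prop :=
  bol_morphism br tr br' tr' f /\ forall x, f (al x) = al' (f x).

Definition twist_br A (be : A -> A) (br : A -> A -> A) (x y : A) : A :=
  be (br x y).

Definition twist_tr A (be : A -> A) (tr : A -> A -> A -> A) (x y z : A) : A :=
  be (be (tr x y z)).

End Definitions.

(* Main.v *)
(** Since [be] commutes with both operations, every power of [be] can be pulled
    out of an iterated twisted product: each Hom-Bol identity for the twisted
    operations is [be ^ n] applied to the corresponding Bol identity, with
    [n = 1, 2, 2, 3, 4] for (3)-(7). *)
Require Import Defs.
From HB Require Import structures.
From mathcomp Require Import all_boot all_algebra.

Set Implicit Arguments.
Unset Strict Implicit.
Unset Printing Implicit Defensive.

Import GRing.Theory.
Local Open Scope ring_scope.

(** Phrased for the bare predicate [linear], so that it applies to each slot of a twisted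
    operation. *)
Lemma linear_comp (K : fieldType) (U V W : lmodType K)
    (g : V -> W) (f : U -> V) :
  linear g -> linear f -> linear (fun x => g (f x)).
Proof. by move=> gL fL a u v; rewrite fL gL. Qed.

Section Twist.
Variables (K : fieldType) (A : superspace K).
Variables (br : A -> A -> A) (tr : A -> A -> A -> A) (be : A -> A).

Lemma twist_br_bilinear : linear be -> bilinear_op br ->
  bilinear_op (twist_br be br).
Proof. by move=> beL [brl brr]; split=> z; apply: linear_comp. Qed.

Lemma twist_tr_trilinear : linear be -> trilinear_op tr ->
  trilinear_op (twist_tr be tr).
Proof.
move=> beL [tr1 tr2 tr3].
by split=> y z; apply: linear_comp => //; apply: linear_comp.
Qed.

(** The exponents follow the arity: every twisted monomial in $n$ variables, with its powers of [be]
    on the arguments, equals [be ^ (n - 1)] of the untwisted one. *)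
Lemma hom_bol_twist : bol br tr -> bol_morphism br tr br tr be ->
  hom_bol (twist_br be br) (twist_tr be tr) be.
Proof.
move=> [brL trL brG trG _ _ _ brA trA trC trB trT] [[beL beG] beB beT].
(* Packing [be] as a linear map gives access to the library lemmas on sums, opposites and
   scalars. *)
pose beM := GRing.isLinear.Build K A A *:%R be beL.
pose bl : {linear A -> A} := HB.pack be beM.
have beD x y : be (x + y) = be x + be y := linearD bl x y.
have beN x : be (- x) = - be x := linearN bl x.
have beZ a x : be (a *: x) = a *: be x := linearZ_LR bl a x.
have be0 : be 0 = 0 := linear0 bl.
split; rewrite /twist_br /twist_tr.
- exact: twist_br_bilinear.
- exact: twist_tr_trilinear.
- by move=> i j x y hx hy; apply/beG/brG.
- by move=> i j k x y z hx hy hz; apply/beG/beG/trG.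
- by [].
- by move=> i j x y _ _; rewrite beB.
- by move=> i j k x y z _ _ _; rewrite !beT.
- by move=> i j x y hx hy; rewrite (brA _ _ _ _ hx hy) beN beZ.
- by move=> i j k x y z hx hy hz; rewrite (trA _ _ _ _ _ _ hx hy hz) !(beN, beZ).
- move=> i j k x y z hx hy hz.
  by rewrite -!beZ -!beD (trC _ _ _ _ _ _ hx hy hz) !be0.
- move=> i j k l x y u v hx hy hu hv.
  (* Read backwards, multiplicativity collects [be] three times in front of each term, which exposes
     the Bol identity. *)
  by rewrite -!(beB, beT) (trB _ _ _ _ _ _ _ _ hx hy hu hv) !(beD, beZ, beN).
- move=> i j k l m x y u v w hx hy hu hv hw.
  (* The inner product carries [be] twice, matching its siblings, so two copies come out and join
     the outer two. *)
  by rewrite -!beT (trT _ _ _ _ _ _ _ _ _ _ hx hy hu hv hw) !(beD, beZ).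
Qed.

End Twist.

(** Intertwining carries [f] past each outer [be], after which the untwisted products are
    preserved. *)
Lemma bol_morphism_twist (K : fieldType) (A A' : superspace K)
    (br : A -> A -> A) (tr : A -> A -> A -> A) (be : A -> A)
    (br' : A' -> A' -> A') (tr' : A' -> A' -> A' -> A') (be' : A' -> A')
    (f : A -> A') :
  bol_morphism br tr br' tr' f -> (forall x, f (be x) = be' (f x)) ->
  hom_bol_morphism (twist_br be br) (twist_tr be tr) be
                   (twist_br be' br') (twist_tr be' tr') be' f.
Proof.
move=> [fL fB fT] fbe; split=> //; split=> // [x y|x y z].
- by rewrite /twist_br fbe fB.
- by rewrite /twist_tr !fbe fT.
Qed.

Theorem corollary4p1 (K : fieldType)
    (hK2 : 2%N \notin [pchar K]) (hK3 : 3%N \notin [pchar K])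
    (A : superspace K) (br : A -> A -> A) (tr : A -> A -> A -> A)
    (be : A -> A)
    (hA : bol br tr) (hbe : bol_morphism br tr br tr be) :
  hom_bol (twist_br be br) (twist_tr be tr) be /\
  forall (A' : superspace K) (br' : A' -> A' -> A')
         (tr' : A' -> A' -> A' -> A') (be' : A' -> A') (f : A -> A'),
    bol br' tr' ->
    bol_morphism br' tr' br' tr' be' ->
    bol_morphism br tr br' tr' f ->
    (forall x, f (be x) = be' (f x)) ->
    hom_bol_morphism (twist_br be br) (twist_tr be tr) be
                     (twist_br be' br') (twist_tr be' tr') be' f.
Proof.
split; first exact: hom_bol_twist.
by move=> A' br' tr' be' f _ _; apply: bol_morphism_twist.
Qed.
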